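(* Let $N\ge 1$ and regard $M_N(\mathbb{R})$ as a real $*$-algebra. Then there is an isomorphism of semigroups $$\operatorname{Pert}(M_N(\mathbb{R})) \cong \left(\mathbb{R}^{(N-1)(N+2)/2} \rtimes M_{(N-1)(N+2)/2}(\mathbb{R})\right) \times M_{N(N-1)/2}(\mathbb{R}).$$ Here the matrix algebras are regarded as semigroups under matrix multiplication, and $\mathbb{R}^{k}\rtimes M_k(\mathbb{R})$ is the set of pairs $(v,B)$ with $v\in\mathbb{R}^k$ a row vector and $B\in M_k(\mathbb{R})$, with semigroup law $(v,B)\cdot(v',B')=(v'+vB',BB')$.
   Context: For a real associative unital $*$-algebra $\mathcal{A}$, the opposite algebra $\mathcal{A}^\circ$ is the vector space $\mathcal{A}$, with elements written $a^\circ$, and product $a^\circ b^\circ=(ba)^\circ$. The perturbation semigroup $\operatorname{Pert}(\mathcal{A})$ is the set of elements of $\mathcal{A}\otimes_{\mathbb{R}}\mathcal{A}^\circ$ of the form $\sum_j a_j\otimes b_j^\circ$ (finite sum) with $\sum_j a_jb_j=1$ and $\sum_j a_j\otimes b_j^\circ=\sum_j b_j^*\otimes a_j^{*\circ}$; it is a unital semigroup under the multiplication of $\mathcal{A}\otimes_{\mathbb{R}}\mathcal{A}^\circ$. The involution on $M_N(\mathbb{R})$ is transposition. *)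

(* Defs.v *)
From HB Require Import structures.
From mathcomp Require Import all_boot all_order all_algebra generic_quotient.
From mathcomp Require Import boolp reals.

Set Implicit Arguments.
Unset Strict Implicit.
Unset Printing Implicit Defensive.

Import GRing.Theory.
Local Open Scope ring_scope.
Local Open Scope quotient_scope.

(* Tensor product of modules over a commutative ring: formal sums of pairs,   *)
(* modulo the least congruence (for concatenation) that makes concatenation   *)
(* commutative and pairing bilinear.                                          *)

Section TensorProduct.
Variables (K : comPzRingType) (V W : lmodType K).

Inductive tensor_rel : seq (V * W) -> seq (V * W) -> Prop :=
| TensorRefl s : tensor_rel s s
| TensorSym s t : tensor_rel s t -> tensor_rel t s
| TensorTrans s t u : tensor_rel s t -> tensor_rel t u -> tensor_rel s u
| TensorCat s s' t t' :
    tensor_rel s s' -> tensor_rel t t' -> tensor_rel (s ++ t) (s' ++ t')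
| TensorComm s t : tensor_rel (s ++ t) (t ++ s)
| TensorZero w : tensor_rel [:: (0, w)] [::]
| TensorAddL v v' w : tensor_rel [:: (v + v', w)] [:: (v, w); (v', w)]
| TensorAddR v w w' : tensor_rel [:: (v, w + w')] [:: (v, w); (v, w')]
| TensorScale c v w : tensor_rel [:: (c *: v, w)] [:: (v, c *: w)].

Definition tensor_relb (s t : seq (V * W)) : bool := `[< tensor_rel s t >].

Lemma tensor_relb_refl : reflexive tensor_relb.
Proof. by move=> s; apply/asboolP; exact: TensorRefl. Qed.

Lemma tensor_relb_sym : symmetric tensor_relb.
Proof. by move=> s t; apply/asboolP/asboolP; exact: TensorSym. Qed.

Lemma tensor_relb_trans : transitive tensor_relb.
Proof.
by move=> t s u /asboolP st /asboolP tu; apply/asboolP; exact: TensorTrans st tu.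
Qed.

Canonical tensor_equiv :=
  EquivRel tensor_relb tensor_relb_refl tensor_relb_sym tensor_relb_trans.

Definition tensor := {eq_quot tensor_equiv}.

HB.instance Definition _ := Choice.on tensor.
HB.instance Definition _ := EqQuotient.on tensor.

Lemma tensor_pi_eqP s t :
  reflect (tensor_rel s t) (\pi_tensor s == \pi_tensor t).
Proof. by rewrite piE; exact: asboolP. Qed.

Lemma tensor_pi_eq s t : tensor_rel s t -> \pi_tensor s = \pi_tensor t.
Proof. by move=> st; apply/eqP/tensor_pi_eqP. Qed.

Lemma tensorW (P : tensor -> Prop) :
  (forall s, P (\pi_tensor s)) -> forall x, P x.
Proof. by move=> Ppi x; rewrite -[x]reprK. Qed.

Lemma tensor_rel_repr s : tensor_rel (repr (\pi_tensor s)) s.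
Proof. by apply/tensor_pi_eqP; rewrite reprK. Qed.

Definition tensor_add (x y : tensor) : tensor := \pi_tensor (repr x ++ repr y).
Definition tensor_zero : tensor := \pi_tensor [::].
Definition tensor_opp (x : tensor) : tensor :=
  \pi_tensor [seq (- p.1, p.2) | p <- repr x].

Lemma tensor_add_pi s t :
  tensor_add (\pi_tensor s) (\pi_tensor t) = \pi_tensor (s ++ t).
Proof. by apply: tensor_pi_eq; apply: TensorCat; exact: tensor_rel_repr. Qed.

Lemma tensor_addA : associative tensor_add.
Proof.
by elim/tensorW=> s; elim/tensorW=> t; elim/tensorW=> u; rewrite !tensor_add_pi catA.
Qed.

Lemma tensor_addC : commutative tensor_add.
Proof.
elim/tensorW=> s; elim/tensorW=> t; rewrite !tensor_add_pi.
by apply: tensor_pi_eq; exact: TensorComm.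
Qed.

Lemma tensor_add0 : left_id tensor_zero tensor_add.
Proof. by elim/tensorW=> s; rewrite tensor_add_pi. Qed.

Lemma tensor_addN : left_inverse tensor_zero tensor_opp tensor_add.
Proof.
move=> x; rewrite -[X in tensor_add _ X]reprK /tensor_opp tensor_add_pi.
elim: (repr x) => [//|[v w] s IHs] /=.
set s' := map _ s in IHs *.
have -> : \pi_tensor ((- v, w) :: s' ++ (v, w) :: s) =
    tensor_add (\pi_tensor [:: (- v, w)])
      (tensor_add (\pi_tensor s')
        (tensor_add (\pi_tensor [:: (v, w)]) (\pi_tensor s))).
  by rewrite !tensor_add_pi.
rewrite (tensor_addA (\pi_tensor s')) (tensor_addC (\pi_tensor s')).
rewrite -tensor_addA tensor_add_pi IHs tensor_addA (tensor_addC _ tensor_zero).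
rewrite tensor_add0 tensor_add_pi /=; apply: tensor_pi_eq.
apply: TensorTrans (TensorZero w).
by rewrite -(addNr v); apply: TensorSym; exact: TensorAddL.
Qed.

HB.instance Definition _ := GRing.isZmodule.Build tensor
  tensor_addA tensor_addC tensor_add0 tensor_addN.

Definition tens (v : V) (w : W) : tensor := \pi_tensor [:: (v, w)].

Lemma tensDl v v' w : tens (v + v') w = tens v w + tens v' w.
Proof.
by rewrite /tens [RHS]tensor_add_pi; apply: tensor_pi_eq; exact: TensorAddL.
Qed.

Lemma tensDr v w w' : tens v (w + w') = tens v w + tens v w'.
Proof.
by rewrite /tens [RHS]tensor_add_pi; apply: tensor_pi_eq; exact: TensorAddR.
Qed.

Lemma tensZlr c v w : tens (c *: v) w = tens v (c *: w).
Proof. by apply: tensor_pi_eq; exact: TensorScale. Qed.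

Lemma tens_pi s : \pi_tensor s = \sum_(p <- s) tens p.1 p.2.
Proof.
elim: s => [|[v w] s IHs]; first by rewrite big_nil.
by rewrite big_cons -IHs [RHS]tensor_add_pi.
Qed.

Lemma tens_repr (x : tensor) : x = \sum_(p <- repr x) tens p.1 p.2.
Proof. by rewrite -tens_pi reprK. Qed.

Section Lift.
Variables (Z : zmodType) (f : V -> W -> Z).
Hypotheses (fDl : forall v v' w, f (v + v') w = f v w + f v' w)
           (fDr : forall v w w', f v (w + w') = f v w + f v w')
           (fZ : forall c v w, f (c *: v) w = f v (c *: w)).

Definition tensor_lift (x : tensor) : Z := \sum_(p <- repr x) f p.1 p.2.

Lemma tensor_lift_rel s t : tensor_rel s t ->
  \sum_(p <- s) f p.1 p.2 = \sum_(p <- t) f p.1 p.2.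
Proof.
elim=> {s t} [//|//|s t u _ -> _ ->//|s s' t t' _ e _ e'|s t|w|v v' w|v w w'|c v w].
- by rewrite !big_cat /= e e'.
- by rewrite !big_cat /= addrC.
- rewrite big_cons !big_nil addr0 /=; apply: (addIr (f 0 w)).
  by rewrite -fDl !add0r.
- by rewrite !big_cons !big_nil !addr0 fDl.
- by rewrite !big_cons !big_nil !addr0 fDr.
- by rewrite !big_cons !big_nil !addr0 fZ.
Qed.

Lemma tensor_lift_pi s : tensor_lift (\pi_tensor s) = \sum_(p <- s) f p.1 p.2.
Proof. by apply: tensor_lift_rel; exact: tensor_rel_repr. Qed.

Lemma tensor_lift_tens v w : tensor_lift (tens v w) = f v w.
Proof. by rewrite tensor_lift_pi big_seq1. Qed.

Lemma tensor_liftD x y : tensor_lift (x + y) = tensor_lift x + tensor_lift y.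
Proof.
elim/tensorW: x => s; elim/tensorW: y => t.
by rewrite [_ + _]tensor_add_pi !tensor_lift_pi big_cat.
Qed.

Lemma tensor_lift0 : tensor_lift 0 = 0.
Proof. by have := tensor_lift_pi [::]; rewrite big_nil. Qed.

Lemma tensor_lift_sum I (r : seq I) (F : I -> tensor) :
  tensor_lift (\sum_(i <- r) F i) = \sum_(i <- r) tensor_lift (F i).
Proof. exact: (big_morph _ tensor_liftD tensor_lift0). Qed.

End Lift.

Lemma tensor_ind (P : tensor -> Prop) :
  (forall v w, P (tens v w)) -> P 0 ->
  (forall x y, P x -> P y -> P (x + y)) -> forall x, P x.
Proof. by move=> Pt P0 PD x; rewrite (tens_repr x); elim/big_ind: _. Qed.

Definition tensor_scale (c : K) : tensor -> tensor :=
  tensor_lift (fun v w => tens (c *: v) w).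

Lemma tensor_scaleD c : {morph tensor_scale c : x y / x + y}.
Proof.
apply: tensor_liftD => [v v' w|v w w'|d v w]; rewrite ?scalerDr ?tensDl ?tensDr //.
by rewrite scalerA mulrC -scalerA tensZlr.
Qed.

Lemma tensor_scale0 c : tensor_scale c 0 = 0.
Proof. by apply: (addIr (tensor_scale c 0)); rewrite -tensor_scaleD !add0r. Qed.

Lemma tensor_scale_tens c v w : tensor_scale c (tens v w) = tens (c *: v) w.
Proof.
apply: (@tensor_lift_tens _ (fun v w => tens (c *: v) w)) => [u u' t|u t t'|d u t];
  rewrite ?scalerDr ?tensDl ?tensDr //.
by rewrite scalerA mulrC -scalerA tensZlr.
Qed.

Lemma tensor_scaleA a b x :
  tensor_scale a (tensor_scale b x) = tensor_scale (a * b) x.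
Proof.
elim/tensor_ind: x => [v w||x y IHx IHy]; first by rewrite !tensor_scale_tens scalerA.
  by rewrite !tensor_scale0.
by rewrite !tensor_scaleD IHx IHy.
Qed.

Lemma tensor_scale1 : left_id 1 tensor_scale.
Proof.
move=> x; elim/tensor_ind: x => [v w||x y IHx IHy].
- by rewrite tensor_scale_tens scale1r.
- exact: tensor_scale0.
- by rewrite tensor_scaleD IHx IHy.
Qed.

Lemma tensor_scaleDl x : {morph tensor_scale^~ x : a b / a + b}.
Proof.
move=> a b; elim/tensor_ind: x => [v w||x y IHx IHy].
- by rewrite !tensor_scale_tens scalerDl tensDl.
- by rewrite !tensor_scale0 addr0.
- by rewrite !tensor_scaleD IHx IHy addrACA.
Qed.

HB.instance Definition _ := GRing.Zmodule_isLmodule.Build K tensor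
  tensor_scaleA tensor_scale1 tensor_scaleD tensor_scaleDl.

Lemma tensZl c v w : tens (c *: v) w = c *: tens v w.
Proof. by rewrite [RHS]tensor_scale_tens. Qed.

Lemma tensZr c v w : tens v (c *: w) = c *: tens v w.
Proof. by rewrite -tensZlr tensZl. Qed.

Lemma tens0l w : tens 0 w = 0.
Proof. by rewrite -(scale0r 0) tensZl scale0r. Qed.

Lemma tens0r v : tens v 0 = 0.
Proof. by rewrite -(scale0r 0) tensZr scale0r. Qed.

Lemma tens_suml I (r : seq I) (F : I -> V) w :
  tens (\sum_(i <- r) F i) w = \sum_(i <- r) tens (F i) w.
Proof.
exact: (big_morph (tens^~ w) (fun v v' => tensDl v v' w) (tens0l w)).
Qed.

Lemma tens_sumr I (r : seq I) (F : I -> W) v :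
  tens v (\sum_(i <- r) F i) = \sum_(i <- r) tens v (F i).
Proof. exact: (big_morph (tens v) (tensDr v) (tens0r v)). Qed.

End TensorProduct.

Section TensorAlgebra.
Variables (K : comPzRingType) (A B : algType K).

Definition tensor_mull (a : A) (b : B) : tensor A B -> tensor A B :=
  tensor_lift (fun a' b' => tens (a * a') (b * b')).

Definition tensor_mul (x y : tensor A B) : tensor A B :=
  tensor_lift (fun a b => tensor_mull a b y) x.

Definition tensor_one : tensor A B := tens 1 1.

Let mull_tens a b a' b' :
  tensor_mull a b (tens a' b') = tens (a * a') (b * b').
Proof.
apply: (@tensor_lift_tens _ _ _ _ (fun a' b' => tens (a * a') (b * b'))).
- by move=> *; rewrite mulrDr tensDl.
- by move=> *; rewrite mulrDr tensDr.
- by move=> *; rewrite -!scalerAr tensZlr.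
Qed.

Let mullD a b : {morph tensor_mull a b : x y / x + y}.
Proof.
apply: tensor_liftD.
- by move=> *; rewrite mulrDr tensDl.
- by move=> *; rewrite mulrDr tensDr.
- by move=> *; rewrite -!scalerAr tensZlr.
Qed.

Let mull0 a b : tensor_mull a b 0 = 0.
Proof. by apply: (addIr (tensor_mull a b 0)); rewrite -mullD !add0r. Qed.

Let mullDl a a' b y :
  tensor_mull (a + a') b y = tensor_mull a b y + tensor_mull a' b y.
Proof.
elim/tensor_ind: y => [c d||x y IHx IHy].
- by rewrite !mull_tens mulrDl tensDl.
- by rewrite !mull0 addr0.
- by rewrite !mullD IHx IHy addrACA.
Qed.

Let mullDr a b b' y :
  tensor_mull a (b + b') y = tensor_mull a b y + tensor_mull a b' y.
Proof.
elim/tensor_ind: y => [c d||x y IHx IHy].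
- by rewrite !mull_tens mulrDl tensDr.
- by rewrite !mull0 addr0.
- by rewrite !mullD IHx IHy addrACA.
Qed.

Let mullZ c a b y : tensor_mull (c *: a) b y = tensor_mull a (c *: b) y.
Proof.
elim/tensor_ind: y => [d e||x y IHx IHy].
- by rewrite !mull_tens -!scalerAl tensZlr.
- by rewrite !mull0.
- by rewrite !mullD IHx IHy.
Qed.

Let mulDl : left_distributive tensor_mul +%R.
Proof.
move=> x y z; apply: (@tensor_liftD _ _ _ _ (fun a b => tensor_mull a b z)).
- by move=> *; exact: mullDl.
- by move=> *; exact: mullDr.
- by move=> *; exact: mullZ.
Qed.

Let mul0l y : tensor_mul 0 y = 0.
Proof. by apply: (addIr (tensor_mul 0 y)); rewrite -mulDl !add0r. Qed.

Let mul_tensl a b y : tensor_mul (tens a b) y = tensor_mull a b y.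
Proof.
apply: (@tensor_lift_tens _ _ _ _ (fun a b => tensor_mull a b y)).
- by move=> *; exact: mullDl.
- by move=> *; exact: mullDr.
- by move=> *; exact: mullZ.
Qed.

Let mulDr : right_distributive tensor_mul +%R.
Proof.
move=> x y z; elim/tensor_ind: x => [a b||x x' IHx IHx'].
- by rewrite !mul_tensl mullD.
- by rewrite !mul0l addr0.
- by rewrite !mulDl IHx IHx' addrACA.
Qed.

Let mul0r x : tensor_mul x 0 = 0.
Proof. by apply: (addIr (tensor_mul x 0)); rewrite -mulDr !add0r. Qed.

Let mulA : associative tensor_mul.
Proof.
move=> x y z; elim/tensor_ind: x => [a b||x x' IHx IHx']; first last.
- by rewrite !mulDl IHx IHx'.
- by rewrite !mul0l.
elim/tensor_ind: y => [a' b'||y y' IHy IHy']; first last.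
- by rewrite mulDl !mulDr mulDl IHy IHy'.
- by rewrite !(mul0l, mul0r).
elim/tensor_ind: z => [a'' b''||z z' IHz IHz']; first last.
- by rewrite !mulDr IHz IHz'.
- by rewrite !mul0r.
by rewrite !(mul_tensl, mull_tens) !mulrA.
Qed.

Let mul1l : left_id tensor_one tensor_mul.
Proof.
move=> x; elim/tensor_ind: x => [a b||x y IHx IHy].
- by rewrite mul_tensl mull_tens !mul1r.
- exact: mul0r.
- by rewrite mulDr IHx IHy.
Qed.

Let mul1r' : right_id tensor_one tensor_mul.
Proof.
move=> x; elim/tensor_ind: x => [a b||x y IHx IHy].
- by rewrite mul_tensl mull_tens !mulr1.
- exact: mul0l.
- by rewrite mulDl IHx IHy.
Qed.

HB.instance Definition _ := GRing.Zmodule_isPzRing.Build (tensor A B)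
  mulA mul1l mul1r' mulDl mulDr.

Lemma tensM (a a' : A) (b b' : B) :
  tens a b * tens a' b' = tens (a * a') (b * b').
Proof. by rewrite [LHS]mul_tensl mull_tens. Qed.

Lemma tens11 : 1 = tens 1 1 :> tensor A B. Proof. by []. Qed.

End TensorAlgebra.

(* The opposite algebra is the library's converse ring A^c, whose product is *)
(* the reversed product of A; it keeps the module structure of A.            *)

HB.instance Definition _ (K : pzRingType) (V : lmodType K) := GRing.Lmodule.on V^c.

Section OppositeAlgebra.
Variables (K : comPzRingType) (A : algType K).

Fact opp_scalerAl (c : K) (x y : A^c) : c *: (x * y : A^c) = (c *: x : A^c) * y.
Proof. exact: (@scalerAr K A c y x). Qed.

HB.instance Definition _ :=
  GRing.Lmodule_isLalgebra.Build K A^c opp_scalerAl.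

Fact opp_scalerAr (c : K) (x y : A^c) : c *: (x * y : A^c) = x * (c *: y : A^c).
Proof. exact: (@scalerAl K A c y x). Qed.

HB.instance Definition _ := GRing.Lalgebra_isAlgebra.Build K A^c opp_scalerAr.

End OppositeAlgebra.

HB.mixin Record isRealStarAlgebra (R : realType) A of GRing.Algebra R A := {
  star : A -> A;
  starD : {morph star : x y / x + y};
  starZ : forall (c : R) x, star (c *: x) = c *: star x;
  starM : forall x y, star (x * y) = star y * star x;
  starK : involutive star
}.

#[short(type="realStarAlgType")]
HB.structure Definition RealStarAlgebra (R : realType) :=
  {A of isRealStarAlgebra R A & GRing.Algebra R A}.

Section MatrixStar.
Variables (R : realType) (n : nat).

Fact mx_starD : {morph (@trmx R n.+1 n.+1) : x y / x + y}.
Proof. exact: linearD. Qed.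

Fact mx_starZ (c : R) (x : 'M[R]_n.+1) : (c *: x)^T = c *: x^T.
Proof. exact: linearZ. Qed.

Fact mx_starM (x y : 'M[R]_n.+1) : (x * y)^T = y^T * x^T.
Proof. exact: trmx_mul. Qed.

HB.instance Definition _ := isRealStarAlgebra.Build R 'M[R]_n.+1
  mx_starD mx_starZ mx_starM (@trmxK R n.+1 n.+1).

End MatrixStar.

Definition mul_monoid (T : Type) : Type := T.

Section MulMonoid.
Variable T : pzRingType.
HB.instance Definition _ := Choice.on (mul_monoid T).
HB.instance Definition _ := isMonoid.Build (mul_monoid T)
  (@mulrA T) (@mul1r T) (@mulr1 T).
End MulMonoid.

Section Perturbation.
Variables (R : realType) (A : realStarAlgType R).

(* p.2 : A^c stands for b° and star p.1 : A^c for ( a^* )°. *)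
Definition is_pert (t : tensor A A^c) : Prop :=
  exists s : seq (A * A),
    [/\ t = \sum_(p <- s) tens p.1 (p.2 : A^c),
        \sum_(p <- s) p.1 * p.2 = 1
      & \sum_(p <- s) tens p.1 (p.2 : A^c) =
        \sum_(p <- s) tens (star p.2) (star p.1 : A^c)].

Definition pert_pred : {pred mul_monoid (tensor A A^c)} :=
  fun t => `[< is_pert t >].

Lemma pert_monoid_closed : monoid_closed pert_pred.
Proof.
split=> [|x y /asboolP[s [-> s1 sC]] /asboolP[t [-> t1 tC]]]; apply/asboolP.
  exists [:: (1, 1)]; have star1 : star (1 : A) = 1.
    by have := starM (star (1 : A)) 1; rewrite mulr1 starK mulr1.
  by rewrite !big_seq1 /= mulr1 star1.
exists [seq (p.1 * q.1, q.2 * p.2) | p <- s, q <- t].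
have mulE (F G : A * A -> A) (F' G' : A * A -> A) :
  (\sum_(p <- s) tens (F p) (G p : A^c)) * (\sum_(q <- t) tens (F' q) (G' q : A^c))
  = \sum_(p <- s) \sum_(q <- t) tens (F p * F' q) (G' q * G p : A^c).
  rewrite mulr_suml; apply: eq_bigr => p _; rewrite mulr_sumr.
  by apply: eq_bigr => q _; rewrite tensM.
split; rewrite ?big_allpairs_dep /=.
- exact: mulE.
- rewrite -s1; apply: eq_bigr => p _; rewrite -[p.1 in RHS]mulr1 -t1.
  by rewrite mulr_sumr mulr_suml; apply: eq_bigr => q _; rewrite !mulrA.
- rewrite -mulE sC tC mulE; apply: eq_bigr => p _; apply: eq_bigr => q _.
  by rewrite !starM.
Qed.

Record Pert := MkPert {
  pert_val :> mul_monoid (tensor A A^c);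
  pert_valP : pert_val \in pert_pred
}.

HB.instance Definition _ := [isSub for pert_val].
HB.instance Definition _ := [Choice of Pert by <:].
HB.instance Definition _ := SubChoice_isSubMonoid.Build
  (mul_monoid (tensor A A^c)) pert_pred Pert pert_monoid_closed.

End Perturbation.

Section Affine.
Variables (R : realType) (k : nat).

Definition semidirect : Type := ('rV[R]_k * 'M[R]_k)%type.

HB.instance Definition _ := Choice.on semidirect.

Definition semidirect_mul (x y : semidirect) : semidirect :=
  (y.1 + x.1 *m y.2, x.2 *m y.2).

Definition semidirect_one : semidirect := (0, 1%:M).

Fact semidirect_mulA : associative semidirect_mul.
Proof.
by move=> x y z; rewrite /semidirect_mul /= mulmxDl !mulmxA addrA.
Qed.

Fact semidirect_mul1 : left_id semidirect_one semidirect_mul.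
Proof. by case=> v B; rewrite /semidirect_mul /= mul0mx addr0 mul1mx. Qed.

Fact semidirect_1mul : right_id semidirect_one semidirect_mul.
Proof. by case=> v B; rewrite /semidirect_mul /= !mulmx1 add0r. Qed.

HB.instance Definition _ := isMonoid.Build semidirect
  semidirect_mulA semidirect_mul1 semidirect_1mul.

End Affine.

Definition semigroup_isomorphic (G H : semigroupType) : Prop :=
  exists f : {multiplicative G -> H}, bijective f.

(* Main.v *)
(* [a (x) b°] acts on M_N(R) by [X |-> a X b]; this identifies
   M_N (x) M_N° with all linear endomorphisms of M_N.  The two conditions
   defining Pert say that the endomorphism fixes the identity and commutes with
   transposition, so it splits into an endomorphism of the symmetric matrices
   fixing the identity and an arbitrary endomorphism of the skew-symmetric ones.
   In a basis of the symmetric matrices starting with the identity, the former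
   has block matrix [[1, v], [0, B]], whose products obey the law of the
   semidirect product. *)
From HB Require Import structures.
Require Import Defs.
From mathcomp Require Import all_boot all_algebra reals.
From mathcomp Require Import boolp zify ring.

Set Implicit Arguments.
Unset Strict Implicit.
Unset Printing Implicit Defensive.

Import GRing.Theory Num.Theory.

(** * The action of $A \otimes A^\circ$ on $A$ by two-sided multiplication *)

Section Sandwich.
Local Open Scope ring_scope.
Variables (K : comPzRingType) (A : algType K).
Implicit Types (s t : tensor A A^c) (X Y : A).

Definition sandwich t X : A :=
  tensor_lift (fun a (b : A^c) => a * X * (b : A)) t.

Lemma sandwichDl s t X : sandwich (s + t) X = sandwich s X + sandwich t X.
Proof.
apply: tensor_liftD => [a a' b|a b b'|c a b].
- by rewrite !mulrDl.
- by rewrite mulrDr.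
- by rewrite -!scalerAl -scalerAr.
Qed.

Lemma sandwich_tens (a b X : A) : sandwich (tens a (b : A^c)) X = a * X * b.
Proof.
apply: (@tensor_lift_tens _ _ _ _ (fun a (b : A^c) => a * X * (b : A)))
  => [x y z|x y z|c x y].
- by rewrite !mulrDl.
- by rewrite mulrDr.
- by rewrite -!scalerAl -scalerAr.
Qed.

Lemma sandwich0l X : sandwich 0 X = 0.
Proof. by apply: (addIr (sandwich 0 X)); rewrite -sandwichDl !add0r. Qed.

Lemma sandwich_suml I (r : seq I) (F : I -> tensor A A^c) X :
  sandwich (\sum_(i <- r) F i) X = \sum_(i <- r) sandwich (F i) X.
Proof.
exact: (big_morph (sandwich^~ X) (fun s t => sandwichDl s t X) (sandwich0l X)).
Qed.

Lemma sandwichDr t X Y : sandwich t (X + Y) = sandwich t X + sandwich t Y.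
Proof.
elim/tensor_ind: t => [a b||s t IHs IHt].
- by rewrite !sandwich_tens mulrDr mulrDl.
- by rewrite !sandwich0l addr0.
- by rewrite !sandwichDl IHs IHt addrACA.
Qed.

Lemma sandwichZr t c X : sandwich t (c *: X) = c *: sandwich t X.
Proof.
elim/tensor_ind: t => [a b||s t IHs IHt].
- by rewrite !sandwich_tens -scalerAr -scalerAl.
- by rewrite !sandwich0l scaler0.
- by rewrite !sandwichDl IHs IHt scalerDr.
Qed.

Lemma sandwichZl t c X : sandwich (c *: t) X = c *: sandwich t X.
Proof.
elim/tensor_ind: t => [a b||s t IHs IHt].
- by rewrite -tensZl !sandwich_tens -!scalerAl.
- by rewrite scaler0 !sandwich0l scaler0.
- by rewrite scalerDr !sandwichDl IHs IHt scalerDr.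
Qed.

Lemma sandwich_linear t : linear (sandwich t).
Proof. by move=> c X Y; rewrite sandwichDr sandwichZr. Qed.

HB.instance Definition _ t :=
  GRing.isLinear.Build K A A _ (sandwich t) (sandwich_linear t).

(** On pure tensors, $a(a'Xb')b = (aa')X(b'b)$, and $b'b$ is the product of [b] and [b'] in [A^c];
    this is where the opposite algebra enters. *)
Lemma sandwichM s t X : sandwich (s * t) X = sandwich s (sandwich t X).
Proof.
elim/tensor_ind: s => [a b||s s' IHs IHs']; first last.
- by rewrite mulrDl !sandwichDl IHs IHs'.
- by rewrite mul0r !sandwich0l.
elim/tensor_ind: t => [a' b'||t t' IHt IHt']; first last.
- by rewrite mulrDr !sandwichDl IHt IHt' linearD.
- by rewrite mulr0 !sandwich0l linear0.
by rewrite tensM !sandwich_tens !mulrA.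
Qed.

End Sandwich.

(** * For matrices, the action identifies tensors with linear endomorphisms *)

Section SandwichMatrix.
Local Open Scope ring_scope.
Variables (K : comNzRingType) (n : nat).
Local Notation A := 'M[K]_n.+1.

(** The coefficients come from $E_{pi} X E_{jq} = X_{ij} E_{pq}$: the tensor $E_{pi} \otimes
    E_{jq}^\circ$ acts as the elementary endomorphism sending $E_{ij}$ to $E_{pq}$. *)
Definition unsandwich (g : A -> A) : tensor A A^c :=
  \sum_i \sum_j \sum_p \sum_q
    g (delta_mx i j) p q *: tens (delta_mx p i) (delta_mx j q : A^c).

Lemma mul_delta_mx_delta (X : A) p i j q :
  (delta_mx p i : A) * X * (delta_mx j q : A) = X i j *: delta_mx p q.
Proof.
rewrite -!mulmxE; apply/matrixP => a b.
rewrite !mxE (bigD1 j) //= big1 => [|k kj]; last first.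
  by rewrite !mxE (negbTE kj) /= mulr0.
rewrite addr0 !mxE (bigD1 i) //= big1 => [|k ki]; last first.
  by rewrite !mxE (negbTE ki) andbF mul0r.
rewrite addr0 !mxE !eqxx andbT /=.
by case: (a == p); case: (b == q); rewrite ?(mul0r, mulr0, mul1r, mulr1).
Qed.

Lemma sandwich_unsandwich (g : {linear A -> A}) : sandwich (unsandwich g) =1 g.
Proof.
move=> X; rewrite [in RHS](matrix_sum_delta X) linear_sum sandwich_suml.
apply: eq_bigr => i _; rewrite linear_sum sandwich_suml; apply: eq_bigr => j _.
rewrite linearZ /= [in RHS](matrix_sum_delta (g _)) scaler_sumr sandwich_suml.
apply: eq_bigr => p _; rewrite scaler_sumr sandwich_suml; apply: eq_bigr => q _.
by rewrite sandwichZl sandwich_tens mul_delta_mx_delta !scalerA mulrC.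
Qed.

(** Both sides are additive in the tensor, so pure tensors suffice; there both factors are expanded
    in matrix units. This makes the action faithful. *)
Lemma unsandwichK : cancel (fun t => sandwich t) unsandwich.
Proof.
move=> t; elim/tensor_ind: t => [a b||s t IHs IHt].
- rewrite [in RHS](matrix_sum_delta a) [in RHS](matrix_sum_delta (b : A)).
  rewrite /unsandwich.
  under eq_bigr => i _ do (rewrite exchange_big /=; under eq_bigr => p _ do
    under eq_bigr => j _ do under eq_bigr => q _ do
      rewrite sandwich_tens).
  rewrite exchange_big /= tens_suml; apply: eq_bigr => p _.
  rewrite tens_suml; apply: eq_bigr => i _.
  rewrite tens_sumr; apply: eq_bigr => j _.
  rewrite tens_sumr; apply: eq_bigr => q _.
  rewrite tensZl tensZr scalerA; congr (_ *: _).
  (* What remains is $(a E_{ij} b)_{pq} = a_{pi} b_{jq}$: each of the two matrix products keeps a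
     single term. *)
  rewrite !mxE (bigD1 j) //= big1 => [|k kj]; last first.
    rewrite !mxE big1 ?mul0r // => l _.
    by rewrite !mxE (negbTE kj) andbF mulr0.
  rewrite addr0 !mxE (bigD1 i) //= big1 => [|k ki]; last first.
    by rewrite !mxE (negbTE ki) mulr0.
  by rewrite !mxE !eqxx mulr1 addr0.
- do 4!apply: big1 => ? _.
  by rewrite sandwich0l mxE scale0r.
- rewrite -[s in RHS]IHs -[t in RHS]IHt /unsandwich.
  do 4!(rewrite -big_split; apply: eq_bigr => ? _).
  by rewrite sandwichDl mxE scalerDl.
Qed.

Lemma sandwich_inj (s t : tensor A A^c) : sandwich s =1 sandwich t -> s = t.
Proof.
by move=> st; rewrite -[s]unsandwichK -[t]unsandwichK (funext st).
Qed.

End SandwichMatrix.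

(** * The perturbation conditions read on endomorphisms *)

Section PertMatrix.
Local Open Scope ring_scope.
Variables (R : realType) (n : nat).
Local Notation A := 'M[R]_n.+1.
Implicit Types t : tensor A A^c.

(** Since $b^T X a^T = (a X^T b)^T$, replacing each $a \otimes b^\circ$ by $b^* \otimes a^{*\circ}$
    conjugates the endomorphism by transposition. *)
Lemma is_pertP t :
  is_pert t <-> sandwich t 1 = 1 /\ forall X, sandwich t X^T = (sandwich t X)^T.
Proof.
have tr_sandwich (s : seq (A * A)) (X : A) :
  sandwich (\sum_(p <- s) tens (star p.2) (star p.1 : A^c)) X =
  (sandwich (\sum_(p <- s) tens p.1 (p.2 : A^c)) X^T)^T.
  rewrite !sandwich_suml raddf_sum; apply: eq_bigr => p _.
  by rewrite !sandwich_tens /= !trmx_mul trmxK mulmxA.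
have sum1E (s : seq (A * A)) :
  sandwich (\sum_(p <- s) tens p.1 (p.2 : A^c)) 1 = \sum_(p <- s) p.1 * p.2.
  by rewrite sandwich_suml; apply: eq_bigr => p _; rewrite sandwich_tens mulr1.
split=> [[s [-> s1 sC]]|[t1 tC]].
  by rewrite sum1E; split=> // X; rewrite [in LHS]sC tr_sandwich trmxK.
(* Both conditions now concern [t] alone, so the sum given by its quotient representative can serve
   as witness; faithfulness turns the second condition back into an equality of tensors. *)
have tE := tens_repr t; exists (generic_quotient.repr t); split=> //.
  by rewrite -sum1E -[X in sandwich X]tE.
by apply: sandwich_inj => X; rewrite tr_sandwich -tE tC trmxK.
Qed.

End PertMatrix.

(** * Matrices of linear maps between column spaces *)

Section ColumnMatrix.
Local Open Scope ring_scope.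
Variables (K : comNzRingType) (k m : nat).

(** Acting on columns makes composition the product in the same order, and makes a linear form a row
    vector, as the semidirect law requires. *)
Definition col_matrix (g : 'cV[K]_k -> 'cV[K]_m) : 'M[K]_(m, k) :=
  \matrix_(i, j) g (delta_mx j 0) i 0.

Lemma mul_col_matrix g u : linear g -> col_matrix g *m u = g u.
Proof.
move=> lin_g; pose L : {linear 'cV[K]_k -> 'cV[K]_m} :=
  HB.pack g (GRing.isLinear.Build _ _ _ _ g lin_g).
rewrite -[g u]/(L u) [in RHS](matrix_sum_delta u) linear_sum.
apply/matrixP => i j; rewrite ord1 summxE mxE; apply: eq_bigr => l _.
by rewrite big_ord1 linearZ /= !mxE mulrC.
Qed.

Lemma col_matrix_mul (M : 'M[K]_(m, k)) g :
  (forall u, g u = M *m u) -> col_matrix g = M.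
Proof.
move=> gM; apply/matrixP => i j; rewrite mxE gM mxE (bigD1 j) //= big1.
  by rewrite mxE !eqxx mulr1 addr0.
by move=> l lj; rewrite mxE (negbTE lj) mulr0.
Qed.

End ColumnMatrix.

(** * Coordinates along the identity, symmetric and skew-symmetric matrices *)

Section Coordinates.
Local Open Scope ring_scope.
Variables (R : realFieldType) (n : nat).
Local Notation A := 'M[R]_n.+1.

Definition upper := {p : 'I_n.+1 * 'I_n.+1 | (p.1 < p.2)%N}.
Definition wupper := {p : 'I_n.+1 * 'I_n.+1 | (p.1 <= p.2)%N && (0 < p.2)%N}.

(** The option receives [insub]: a pair outside the index set reads as 0, which gives the (0, 0)
    entry of [sym_mx] and leaves at most one nonzero term in each entry of [skew_mx]. *)
Definition coord (I : finType) (v : 'cV[R]_#|I|) (o : option I) : R :=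
  oapp (fun p => v (enum_rank p) 0) 0 o.

Lemma coord_linear (I : finType) c (u v : 'cV[R]_#|I|) o :
  coord (c *: u + v) o = c * coord u o + coord v o.
Proof. by case: o => [p|] /=; rewrite ?mxE // mulr0 addr0. Qed.

(* Together with the identity, the range of [sym_mx] spans the symmetric
   matrices: [wupper] omits (0, 0), so these matrices vanish there. *)
Definition sym_mx (v : 'cV[R]_#|{: wupper}|) : A :=
  \matrix_(i, j) coord v (insub (if (i <= j)%N then (i, j) else (j, i))).

Definition skew_mx (w : 'cV[R]_#|{: upper}|) : A :=
  \matrix_(i, j) (coord w (insub (i, j)) - coord w (insub (j, i))).

(** These are the entries of the symmetric part of $X - X_{00} 1$, that is, the projection along the
    identity and the skew matrices. *)
Definition sym_coord (X : A) : 'cV[R]_#|{: wupper}| :=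
  \col_k let p := val (enum_val k) in
         (X p.1 p.2 + X p.2 p.1) / 2 - (p.1 == p.2)%:R * X 0 0.

Definition skew_coord (X : A) : 'cV[R]_#|{: upper}| :=
  \col_k let p := val (enum_val k) in (X p.1 p.2 - X p.2 p.1) / 2.

Lemma sym_mx_linear : linear sym_mx.
Proof. by move=> c u v; apply/matrixP => i j; rewrite !mxE coord_linear. Qed.

Lemma skew_mx_linear : linear skew_mx.
Proof.
by move=> c u v; apply/matrixP => i j; rewrite !mxE !coord_linear; ring.
Qed.

Lemma sym_coord_linear : linear sym_coord.
Proof. move=> c X Y; apply/matrixP => i j; rewrite !mxE /= !mxE; ring. Qed.

Lemma skew_coord_linear : linear skew_coord.
Proof. by move=> c X Y; apply/matrixP => i j; rewrite !mxE /= !mxE; ring. Qed.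

HB.instance Definition _ := GRing.isLinear.Build R _ A _ sym_mx sym_mx_linear.
HB.instance Definition _ := GRing.isLinear.Build R _ A _ skew_mx skew_mx_linear.
HB.instance Definition _ :=
  GRing.isLinear.Build R A _ _ sym_coord sym_coord_linear.
HB.instance Definition _ :=
  GRing.isLinear.Build R A _ _ skew_coord skew_coord_linear.

Lemma tr_sym_mx v : (sym_mx v)^T = sym_mx v.
Proof.
apply/matrixP => i j; rewrite !mxE.
by case: ltngtP => // /val_inj ->.
Qed.

Lemma tr_skew_mx w : (skew_mx w)^T = - skew_mx w.
Proof. by apply/matrixP => i j; rewrite !mxE opprB. Qed.

Lemma sym_mx00 v : sym_mx v 0 0 = 0.
Proof. by rewrite mxE insubF. Qed.

Lemma sym_coord_tr X : sym_coord X^T = sym_coord X.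
Proof. by apply/matrixP => i j; rewrite !mxE /= !mxE; ring. Qed.

Lemma skew_coord_tr X : skew_coord X^T = - skew_coord X.
Proof. by apply/matrixP => i j; rewrite !mxE /= !mxE; ring. Qed.

Lemma sym_coord1 : sym_coord 1%:M = 0.
Proof.
apply/matrixP => i j; rewrite !mxE /= !mxE (eq_sym _ (sval _).1).
by case: eqP => _ /=; field.
Qed.

Lemma eq_opp_eq0 (V : lmodType R) (x : V) : x = - x -> x = 0.
Proof.
move=> /eqP; rewrite -addr_eq0 -mulr2n -scaler_nat scaler_eq0 pnatr_eq0 /=.
by move/eqP.
Qed.

Lemma skew_coord_sym X : X^T = X -> skew_coord X = 0.
Proof. by move=> XT; apply: eq_opp_eq0; rewrite -skew_coord_tr XT. Qed.

Lemma sym_coord_skew X : X^T = - X -> sym_coord X = 0.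
Proof.
by move=> XT; apply: eq_opp_eq0; rewrite -{1}(sym_coord_tr X) XT linearN.
Qed.

Lemma diag_skew (X : A) i : X^T = - X -> X i i = 0.
Proof.
by move=> /matrixP/(_ i i); rewrite !mxE; exact: (@eq_opp_eq0 R^o).
Qed.

Lemma sym_mxK : cancel sym_mx sym_coord.
Proof.
move=> v; apply/matrixP => k j; rewrite ord1 mxE /= sym_mx00 mulr0 subr0.
set p := enum_val k.
have /andP[le_p gt0] := valP p.
have E : sym_mx v (val p).1 (val p).2 = v k 0.
  by rewrite mxE le_p -surjective_pairing valK /= enum_valK.
have := tr_sym_mx v => /matrixP/(_ (val p).1 (val p).2); rewrite mxE /= => ->.
by rewrite E; field.
Qed.

Lemma skew_mxK : cancel skew_mx skew_coord.
Proof.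
move=> v; apply/matrixP => k j; rewrite ord1 mxE /=.
set p := enum_val k.
have lt_p := valP p.
have E : skew_mx v (val p).1 (val p).2 = v k 0.
  rewrite mxE -surjective_pairing valK /= enum_valK insubF ?subr0 //=.
  by apply/negbTE; rewrite -leqNgt ltnW.
have := tr_skew_mx v => /matrixP/(_ (val p).1 (val p).2).
rewrite !mxE /= in E * => ->.
by rewrite E; field.
Qed.

Lemma sym_skew_decomp (X : A) :
  X = (X 0 0)%:M + sym_mx (sym_coord X) + skew_mx (skew_coord X).
Proof.
apply/matrixP => i j; rewrite !mxE.
have symE (a b : 'I_n.+1) : (a <= b)%N -> coord (sym_coord X) (insub (a, b)) =
    (X a b + X b a) / 2 - (a == b)%:R * X 0 0.
  move=> le_ab; case: insubP => [p _ pE|] /=.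
    by rewrite mxE enum_rankK pE.
  (* With $a \le b$, a pair outside [wupper] can only be (0, 0), where the right-hand side is
     $X_{00} - X_{00}$, matching the default 0. *)
  rewrite /= le_ab /= -eqn0Ngt => /eqP b0.
  have {}b0 : b = 0 by exact: val_inj.
  have a0 : a = 0 by apply: val_inj; move: le_ab; rewrite b0 leqn0 => /eqP.
  by rewrite a0 b0 eqxx mul1r; field.
have skewE (a b : 'I_n.+1) : coord (skew_coord X) (insub (a, b)) =
    if (a < b)%N then (X a b - X b a) / 2 else 0.
  case: insubP => [p lt_p pE|/negbTE /= -> //].
  by rewrite /= in lt_p; rewrite lt_p /= mxE enum_rankK pE.
rewrite !skewE -val_eqE.
case: ltngtP => ij.
- by rewrite (symE _ _ (ltnW ij)) -val_eqE /= (ltn_eqF ij) /= mulr0n; field.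
- by rewrite (symE _ _ (ltnW ij)) -val_eqE /= (ltn_eqF ij) /= mulr0n; field.
- by rewrite -(val_inj ij) (symE _ _ (leqnn i)) eqxx /= mulr1n; field.
Qed.

End Coordinates.

(** * Dimensions of the two coordinate spaces *)

Section CardinalIndices.
Variable n : nat.

Lemma sum_ord_below (m p : nat) : (m <= p)%N -> \sum_(i < p | (i < m)%N) 1 = m.
Proof.
move=> le_mp; rewrite -(big_ord_widen p (fun=> 1)) //.
by rewrite sum_nat_const card_ord muln1.
Qed.

Lemma card_upper : #|{: upper n}| = (n.+1 * (n.+1 - 1)) %/ 2.
Proof.
have -> : #|{: upper n}| = \sum_(j < n.+1) j.
  transitivity (\sum_(i : 'I_n.+1) \sum_(j : 'I_n.+1 | i < j) 1).
    by rewrite pair_big_dep /= card_sig -sum1_card.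
  rewrite (exchange_big_dep xpredT) //=; apply: eq_bigr => j _.
  by apply: sum_ord_below; exact: ltnW.
(* Doubling keeps the induction free of truncated division. *)
have E m : (\sum_(j < m.+1) j) * 2 = m.+1 * m.
  elim: m => [|m IHm]; first by rewrite big_ord1.
  by rewrite big_ord_recr /= mulnDl IHm; lia.
by rewrite subn1 /= -E mulnK.
Qed.

Lemma card_wupper : #|{: wupper n}| = ((n.+1 - 1) * (n.+1 + 2)) %/ 2.
Proof.
(* Count by columns: column 0 is empty, and the summation index [j] stands for column [j.+1], which
   has [j.+2] admissible rows. *)
have -> : #|{: wupper n}| = \sum_(j < n) j.+2.
  transitivity (\sum_(i : 'I_n.+1) \sum_(j : 'I_n.+1 | (i <= j) && (0 < j)) 1).
    by rewrite pair_big_dep /= card_sig -sum1_card.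
  rewrite (exchange_big_dep xpredT) //= big_ord_recl.
  rewrite big_pred0 => [|i]; last by rewrite andbF.
  apply: eq_bigr => j _; rewrite -[RHS](@sum_ord_below j.+2 n.+1 (ltn_ord j)).
  by apply: eq_bigl => i; rewrite andbT.
have E m : (\sum_(j < m) j.+2) * 2 = m * m.+3.
  elim: m => [|m IHm]; first by rewrite big_ord0.
  by rewrite big_ord_recr /= mulnDl IHm; lia.
by rewrite subn1 addn2 /= -E mulnK.
Qed.

End CardinalIndices.

(** * The isomorphism in coordinates *)

Section PertCoordinates.
Local Open Scope ring_scope.
Variables (R : realType) (n : nat).
Local Notation A := 'M[R]_n.+1.
Local Notation k := #|{: wupper n}|.
Local Notation m := #|{: upper n}|.
Local Notation target := (semidirect R k * mul_monoid 'M[R]_m)%type.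
Implicit Types (t : tensor A A^c).

(** The (0, 0) entry is the coefficient along the identity, because [sym_mx] and [skew_mx] vanish
    there. *)
Definition shift_part t : 'rV[R]_k :=
  col_matrix (fun v => (sandwich t (sym_mx v) 0 0)%:M : 'cV[R]_1).
Definition sym_part t : 'M[R]_k :=
  col_matrix (fun v => sym_coord (sandwich t (sym_mx v))).
Definition skew_part t : 'M[R]_m :=
  col_matrix (fun w => skew_coord (sandwich t (skew_mx w))).

Definition pert_coord t : target := ((shift_part t, sym_part t), skew_part t).

Lemma shift_partE t v : shift_part t *m v = (sandwich t (sym_mx v) 0 0)%:M.
Proof.
apply: mul_col_matrix => c u w; rewrite !linearP.
by apply/matrixP => i j; rewrite !mxE !ord1 eqxx.
Qed.

Lemma sym_partE t v : sym_part t *m v = sym_coord (sandwich t (sym_mx v)).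
Proof. by apply: mul_col_matrix => c u w; rewrite !linearP. Qed.

Lemma skew_partE t w : skew_part t *m w = skew_coord (sandwich t (skew_mx w)).
Proof. by apply: mul_col_matrix => c u v; rewrite !linearP. Qed.

(** The endomorphism with prescribed blocks: $[[1, v], [0, B]]$ on the symmetric part and $C$ on the
    skew part, for [x] = $((v, B), C)$. *)
Definition affine_act (x : target) (X : A) : A :=
  (X 0 0)%:M + (((x.1.1 *m sym_coord X) 0 0)%:M + sym_mx (x.1.2 *m sym_coord X))
  + skew_mx ((x.2 : 'M[R]_m) *m skew_coord X).

Lemma affine_act_linear x : linear (affine_act x).
Proof.
move=> c X Y; rewrite /affine_act !linearP /=.
set a := _ *m sym_coord X; set b := _ *m sym_coord Y.
set D := sym_mx _; set D' := sym_mx _; set E := skew_mx _; set E' := skew_mx _.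
by apply/matrixP => i j; rewrite !mxE; case: eqP => _ /=; ring.
Qed.

HB.instance Definition _ x :=
  GRing.isLinear.Build R A A _ (affine_act x) (affine_act_linear x).

Lemma affine_act1 x : affine_act x 1 = 1.
Proof.
rewrite /affine_act sym_coord1 skew_coord_sym ?trmx1 // !mulmx0 !linear0.
by rewrite !mxE raddf0 !addr0.
Qed.

Lemma affine_act_tr x X : affine_act x X^T = (affine_act x X)^T.
Proof.
rewrite /affine_act sym_coord_tr skew_coord_tr mulmxN linearN /= mxE.
by rewrite !linearD /= !tr_scalar_mx tr_sym_mx tr_skew_mx.
Qed.

Lemma affine_act_sym x v :
  affine_act x (sym_mx v) = ((x.1.1 *m v) 0 0)%:M + sym_mx (x.1.2 *m v).
Proof.
rewrite /affine_act sym_mxK sym_mx00 skew_coord_sym ?tr_sym_mx //.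
by rewrite mulmx0 linear0 raddf0 add0r addr0.
Qed.

Lemma affine_act_skew x w :
  affine_act x (skew_mx w) = skew_mx ((x.2 : 'M[R]_m) *m w).
Proof.
have skw := tr_skew_mx w.
rewrite /affine_act skew_mxK diag_skew // sym_coord_skew //.
by rewrite !mulmx0 linear0 mxE raddf0 !add0r.
Qed.

Lemma sandwich_pert t : is_pert t -> sandwich t =1 affine_act (pert_coord t).
Proof.
move=> /is_pertP[t1 tC] X; rewrite [in LHS](sym_skew_decomp X) !linearD /=.
have -> : sandwich t (X 0 0)%:M = (X 0 0)%:M.
  by rewrite -scalemx1 linearZ /= t1.
rewrite /affine_act /= shift_partE sym_partE skew_partE mxE eqxx mulr1n.
set S := sandwich t (sym_mx _); set W := sandwich t (skew_mx _).
(* Commuting with transposition preserves the symmetric and skew parts, so the mixed blocks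
   vanish. *)
have ST : S^T = S by rewrite -tC tr_sym_mx.
have WT : W^T = - W by rewrite -tC tr_skew_mx linearN.
rewrite [in LHS](sym_skew_decomp S) [in LHS](sym_skew_decomp W).
rewrite (skew_coord_sym ST) (sym_coord_skew WT) (diag_skew 0 WT).
by rewrite !linear0 raddf0 !addr0 !add0r.
Qed.

(** The blocks are recovered by evaluating on [sym_mx] and [skew_mx]. Multiplicativity and
    surjectivity of [pert_iso] both reduce to this. *)
Lemma pert_coord_unique t x : sandwich t =1 affine_act x -> pert_coord t = x.
Proof.
case: x => [[v B] C] tE; congr ((_, _), _); apply: col_matrix_mul => u.
- rewrite tE affine_act_sym /= [RHS]mx11_scalar; congr _%:M.
  by rewrite mxE sym_mx00 addr0 mxE eqxx mulr1n.
- rewrite tE affine_act_sym linearD /= sym_mxK -scalemx1 linearZ /=.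
  by rewrite sym_coord1 scaler0 add0r.
- by rewrite tE affine_act_skew skew_mxK.
Qed.

(** Block multiplication: the scalar produced by [y] is fixed by [x], while the symmetric output of
    [y] passes through the row of [x], giving $v' + vB'$. *)
Lemma affine_actM (x y : target) X :
  affine_act (x * y)%g X = affine_act x (affine_act y X).
Proof.
have act_scalar c : affine_act x c%:M = c%:M.
  by rewrite -scalemx1 linearZ /= affine_act1.
rewrite [affine_act y X]/affine_act !linearD /= !act_scalar.
rewrite affine_act_sym affine_act_skew /affine_act /=.
rewrite [(x.2 * y.2)%g]/(x.2 *m y.2 : 'M[R]_m).
by rewrite mulmxDl -!mulmxA [((_ + _) : 'M_1) _ _]mxE raddfD /= !addrA.
Qed.

Definition pert_of_coord (x : target) : mul_monoid (tensor A A^c) :=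
  unsandwich (affine_act x).

Lemma sandwich_pert_of_coord x : sandwich (pert_of_coord x) =1 affine_act x.
Proof. exact: sandwich_unsandwich. Qed.

Lemma pert_of_coordP x : pert_of_coord x \in pert_pred (A := A).
Proof.
apply/asboolP/is_pertP; rewrite sandwich_pert_of_coord affine_act1.
split=> // X.
by rewrite !sandwich_pert_of_coord affine_act_tr.
Qed.

Definition pert_iso (t : Pert A) : target := pert_coord (pert_val t).

(** Products become compositions on both sides, so uniqueness of coordinates applies. *)
Lemma pert_isoM : {morph pert_iso : s t / (s * t)%g}.
Proof.
move=> s t; apply: pert_coord_unique => X; rewrite affine_actM.
rewrite -(sandwich_pert (asboolW (pert_valP t))).
rewrite -(sandwich_pert (asboolW (pert_valP s))).
by rewrite -sandwichM.
Qed.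

HB.instance Definition _ := isMultiplicative.Build (Pert A) target
  pert_iso pert_isoM.

Lemma pert_iso_bij : bijective pert_iso.
Proof.
exists (fun x => MkPert (pert_of_coordP x)) => [t|x]; last first.
  by apply: pert_coord_unique; exact: sandwich_pert_of_coord.
apply: val_inj; apply: sandwich_inj => X /=.
by rewrite sandwich_pert_of_coord -sandwich_pert //; exact/asboolP/pert_valP.
Qed.

End PertCoordinates.

Theorem proposition3p12 (R : realType) (n : nat) :
  let N := n.+1 in
  semigroup_isomorphic
    (Pert 'M[R]_N)
    (semidirect R (((N - 1) * (N + 2)) %/ 2) *
     mul_monoid 'M[R]_((N * (N - 1)) %/ 2))%type.
Proof.
(* Turning the numerical sizes into cardinalities makes the target the one of [pert_iso], with no
   cast between matrix sizes. *)
rewrite /= -card_upper -card_wupper.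
by exists (@pert_iso R n); exact: pert_iso_bij.
Qed.
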